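(* Let $A\in\mathbb{R}^3\setminus\{0\}$, let $\alpha,\beta$ be any real constants, and for $j=1,2,\ldots$ define $$\Psi_{j\alpha\beta}(r)=\alpha\frac1r\sin(jr)+\beta\frac1r\cos(jr),\qquad \Phi_{j\alpha\beta}(r)=j\,\Psi_{j\alpha\beta}(r).$$ Then, for every $j=1,2,\ldots$, $$u=(A\times\nabla)\Phi_{j\alpha\beta}+\{(A\times\nabla)\times\nabla\}\Psi_{j\alpha\beta}$$ is a solution of the static three-dimensional Euler equations $$(u\cdot\nabla)u+\nabla P=0,\qquad \nabla\cdot u=0,$$ with symplectic representation $u=(A\times\nabla)\phi+\{(A\times\nabla)\times\nabla\}\psi$ and periodic boundary condition $$\{\xi\phi(\xi)\}\big|_{\xi=r+2\pi}=r\phi(r),\qquad \{\xi\psi(\xi)\}\big|_{\xi=r+2\pi}=r\psi(r),\qquad \forall r\ge0.$$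
   Context: Here $x\in\mathbb{R}^3$, $r=|x|$, $u$ is the velocity field, $P$ is the scalar pressure (an unknown of the equations). For a constant vector $A$, $A\times\nabla$ is the vector of first-order operators given by the formal cross product, and $(A\times\nabla)\times\nabla=(A\cdot\nabla)\nabla-A\Delta$. The functions $\phi,\psi$ in the symplectic representation are radial, here $\phi=\Phi_{j\alpha\beta}$ and $\psi=\Psi_{j\alpha\beta}$. *)

(* Defs.v *)
(* Stdlib reals with Coquelicot. *)
From Stdlib Require Import Reals.
From Coquelicot Require Import Coquelicot.
Open Scope R_scope.

Definition R3 : Type := (R * R * R)%type.

Inductive axis : Set := ax1 | ax2 | ax3.

Definition vec (g : axis -> R) : R3 := (g ax1, g ax2, g ax3).

Definition coord (i : axis) (x : R3) : R :=
  match i with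
  | ax1 => fst (fst x)
  | ax2 => snd (fst x)
  | ax3 => snd x
  end.

Definition update (i : axis) (x : R3) (t : R) : R3 :=
  match i with
  | ax1 => (t, coord ax2 x, coord ax3 x)
  | ax2 => (coord ax1 x, t, coord ax3 x)
  | ax3 => (coord ax1 x, coord ax2 x, t)
  end.

Definition sum3 (g : axis -> R) : R := g ax1 + g ax2 + g ax3.

Definition add3 (a b : R3) : R3 := vec (fun i => coord i a + coord i b).

Definition dot (a b : R3) : R := sum3 (fun i => coord i a * coord i b).

Definition cross (a b : R3) : R3 :=
  (coord ax2 a * coord ax3 b - coord ax3 a * coord ax2 b,
   coord ax3 a * coord ax1 b - coord ax1 a * coord ax3 b,
   coord ax1 a * coord ax2 b - coord ax2 a * coord ax1 b).

Definition radius (x : R3) : R := sqrt (dot x x).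

(* [Derive] is total: [partial i f x] is meaningful only where the derivative
   exists, which is what [C_on] below guarantees. *)
Definition partial (i : axis) (f : R3 -> R) (x : R3) : R :=
  Derive (fun t => f (update i x t)) (coord i x).

Definition grad (f : R3 -> R) (x : R3) : R3 := vec (fun i => partial i f x).

Definition laplacian (f : R3 -> R) (x : R3) : R :=
  sum3 (fun i => partial i (partial i f) x).

Definition component (i : axis) (u : R3 -> R3) : R3 -> R :=
  fun x => coord i (u x).

Definition divergence (u : R3 -> R3) (x : R3) : R :=
  sum3 (fun i => partial i (component i u) x).

(* (a . nabla) f *)
Definition directional (a : R3) (f : R3 -> R) (x : R3) : R := dot a (grad f x).

(* (u . nabla) v *)
Definition advect (u v : R3 -> R3) (x : R3) : R3 :=
  vec (fun i => directional (u x) (component i v) x).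

(* (A x nabla) f *)
Definition cross_grad (A : R3) (f : R3 -> R) (x : R3) : R3 := cross A (grad f x).

(* {(A x nabla) x nabla} f = (A . nabla) nabla f - A Delta f *)
Definition cross_grad_cross_grad (A : R3) (f : R3 -> R) (x : R3) : R3 :=
  vec (fun i => directional A (partial i f) x - coord i A * laplacian f x).

(* Functions of class C^n on D, for D open. *)
Fixpoint C_on (n : nat) (D : R3 -> Prop) (f : R3 -> R) : Prop :=
  (forall x, D x -> continuous f x) /\
  match n with
  | O => True
  | S m => forall i,
      (forall x, D x -> ex_derive (fun t => f (update i x t)) (coord i x)) /\
      C_on m D (partial i f)
  end.

Definition radial (f : R -> R) (x : R3) : R := f (radius x).

Definition symplectic_representation (D : R3 -> Prop) (A : R3)
    (phi psi : R -> R) (u : R3 -> R3) : Prop :=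
  C_on 1 D (radial phi) /\ C_on 2 D (radial psi) /\
  forall x, D x ->
    u x = add3 (cross_grad A (radial phi) x)
               (cross_grad_cross_grad A (radial psi) x).

Definition static_euler (D : R3 -> Prop) (u : R3 -> R3) (P : R3 -> R) : Prop :=
  (forall i, C_on 1 D (component i u)) /\ C_on 1 D P /\
  forall x, D x ->
    add3 (advect u u x) (grad P x) = (0, 0, 0) /\ divergence u x = 0.

(* The function xi |-> xi * f xi is taken on [0, +oo) with its limit as value
   at 0: f itself may blow up like 1 / xi there. *)
Definition periodic_boundary (f : R -> R) : Prop :=
  exists w : R -> R,
    (forall xi, 0 < xi -> w xi = xi * f xi) /\
    filterlim w (at_right 0) (locally (w 0)) /\
    (forall r, 0 <= r -> w (r + 2 * PI) = w r).

(* (1 / r) sin (j r), with its removable singularity at r = 0 filled in. *)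
Definition sin_over_r (j : nat) (r : R) : R :=
  if Req_EM_T r 0 then INR j else / r * sin (INR j * r).

Definition Psi (j : nat) (alpha beta : R) (r : R) : R :=
  alpha * sin_over_r j r + beta * (/ r * cos (INR j * r)).

Definition Phi (j : nat) (alpha beta : R) (r : R) : R :=
  INR j * Psi j alpha beta r.

(* Where Psi (|x|) is regular: the cosine term is singular at the origin, so
   the origin belongs to the domain exactly when that term is absent. *)
Definition regular_domain (beta : R) (x : R3) : Prop := x <> (0, 0, 0) \/ beta = 0.

(* Main.v *)
(** Write [s = |x|^2].  The function [psi] is a radial solution of the Helmholtz
    equation [Delta psi = - j^2 psi], so that [curl curl (A psi) =
    (A x nabla) x nabla psi], [curl (A psi) = - (A x nabla) psi] and
    [u = - j curl (A psi) + curl curl (A psi)] satisfies [curl u = - j u]: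
    it is a Beltrami field.  Hence [u x curl u = 0] and [(u . nabla) u] is
    [nabla (|u|^2 / 2)], which is balanced by [P = - |u|^2 / 2].

    To differentiate [psi] also at the origin, write it as [h 0 s], where
    [h 0, h 1, ...] are successive derivatives in [s]: then
    [partial_i (h k |x|^2) = 2 x_i h (k + 1) |x|^2], and the Helmholtz equation
    becomes the recurrence in [helmholtz_profile]. *)
Require Import Defs.
From Stdlib Require Import Reals Lra Lia FunctionalExtensionality.
From Coquelicot Require Import Coquelicot.
Open Scope R_scope.

(** * Radial profiles of the Helmholtz equation *)

(** Since [Delta (h 0 |x|^2) = 6 h 1 + 4 s h 2], the case [k = 0] is the Helmholtz equation;
    differentiating [4 s h 2] in [s] a further [k] times adds [4 k] to the middle coefficient. The
    property is pointwise in [s] because the cosine solution has it only for [s > 0]. *)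
Definition helmholtz_profile (c : R) (h : nat -> R -> R) (s : R) : Prop :=
  forall k,
    is_derive (h k) s (h (S k) s) /\
    (4 * INR k + 6) * h (S k) s + 4 * s * h (S (S k)) s + c ^ 2 * h k s = 0.

(** [sin_n] lists the Taylor coefficients [(-1)^n / (2n+1)!] of [sin r / r] in the variable
    [s = r^2]. Working with the entire series keeps [s = 0] an ordinary point. *)
Definition sin_profile (k : nat) : R -> R :=
  PSeries (Nat.iter k PS_derive sin_n).

Lemma CV_radius_sin_n (k : nat) :
  CV_radius (Nat.iter k PS_derive sin_n) = p_infty.
Proof.
  induction k as [|k IH].
  - apply CV_radius_infinite_DAlembert.
    + exact sin_no_R0.
    + apply is_lim_seq_Reals. exact Alembert_sin.
  - simpl. now rewrite CV_radius_derive.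
Qed.

Lemma is_derive_sin_profile (k : nat) (s : R) :
  is_derive (sin_profile k) s (sin_profile (S k) s).
Proof.
  apply is_derive_PSeries. now rewrite CV_radius_sin_n.
Qed.

(** This is the equation [6 h' + 4 s h'' + h = 0] read on the coefficient of [s^n]: there [h'] and
    [s h''] contribute [6 (n+1)] and [4 n (n+1)], and [(n+1) (4n+6) = (2n+2) (2n+3)]. *)
Lemma sin_n_succ (n : nat) :
  (2 * INR n + 2) * (2 * INR n + 3) * sin_n (S n) = - sin_n n.
Proof.
  unfold sin_n.
  replace (2 * S n + 1)%nat with (S (S (2 * n + 1))) by lia.
  rewrite 2!fact_simpl, 2!mult_INR, 2!S_INR, plus_INR, mult_INR.
  simpl (INR 2). simpl (INR 1). simpl ((-1) ^ S n).
  assert (Hf := INR_fact_neq_0 (2 * n + 1)).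
  assert (Hn := pos_INR n).
  field. repeat split; try exact Hf; lra.
Qed.

Lemma helmholtz_profile_sin (s : R) : helmholtz_profile 1 sin_profile s.
Proof.
  intros k. split; [apply is_derive_sin_profile|].
  (* The point [s] is generalized because the induction step differentiates the identity, which must
     therefore hold near [s] and not only at [s]. *)
  revert s. induction k as [|k IH]; intros s.
  - assert (E : PS_plus (PS_plus (PS_scal 6 (PS_derive sin_n))
                  (PS_scal 4 (PS_incr_1 (PS_derive (PS_derive sin_n))))) sin_n
                = (fun _ => 0)).
    { apply functional_extensionality. intros [|n].
      - unfold PS_plus, PS_scal, PS_derive, PS_incr_1, plus, scal, zero; simpl.
        unfold mult; simpl.
        assert (H := sin_n_succ 0). simpl in H. lra.
      - unfold PS_plus, PS_scal, PS_derive, PS_incr_1, plus, scal; simpl.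
        unfold mult; simpl.
        assert (H := sin_n_succ (S n)).
        destruct n as [|n]; simpl in *; lra. }
    assert (X : forall k, ex_pseries (Nat.iter k PS_derive sin_n) s).
    { intros k. apply CV_radius_inside. now rewrite CV_radius_sin_n. }
    assert (X1 : ex_pseries (PS_scal 6 (PS_derive sin_n)) s).
    { apply ex_pseries_scal; [apply Rmult_comm | exact (X 1%nat)]. }
    assert (X2 : ex_pseries
              (PS_scal 4 (PS_incr_1 (PS_derive (PS_derive sin_n)))) s).
    { apply ex_pseries_scal; [apply Rmult_comm|].
      apply ex_pseries_incr_1. exact (X 2%nat). }
    apply (f_equal (fun a => PSeries a s)) in E.
    rewrite PSeries_const_0, PSeries_plus, PSeries_plus, 2!PSeries_scal,
      PSeries_incr_1 in E;
      [ | exact X1 | exact X2 | now apply ex_pseries_plus | exact (X 0%nat)].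
    unfold sin_profile. simpl. simpl in E. lra.
  (* The left side of the identity at level [k] vanishes identically, so its derivative is 0; the
     term coming from [4 t] raises [4 k + 6] to [4 (k + 1) + 6]. *)
  - assert (D : is_derive (fun t => (4 * INR k + 6) * sin_profile (S k) t
        + 4 * t * sin_profile (S (S k)) t + 1 ^ 2 * sin_profile k t) s
      ((4 * INR k + 6) * sin_profile (S (S k)) s
        + (4 * sin_profile (S (S k)) s + 4 * s * sin_profile (S (S (S k))) s)
        + 1 ^ 2 * sin_profile (S k) s)).
    { auto_derive.
      - repeat split; eexists; apply is_derive_sin_profile.
      - rewrite !(is_derive_unique _ _ _ (is_derive_sin_profile _ _)). ring. }
    apply (is_derive_ext _ (fun _ => 0)) in D; [|intros t; apply IH].
    apply is_derive_unique in D. rewrite Derive_const in D.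
    rewrite S_INR. lra.
Qed.

(** The library defines [sin t] as [t] times the sum of this very series at [t^2]. *)
Lemma sin_profile_sqr (t : R) : sin t = t * sin_profile 0 (t ^ 2).
Proof.
  rewrite <- Rsqr_pow2. unfold sin. destruct (exist_sin (Rsqr t)) as [l Hl].
  f_equal. symmetry.
  apply (is_series_unique (fun n => sin_n n * Rsqr t ^ n)), is_series_Reals.
  exact Hl.
Qed.

Lemma helmholtz_profile_scale (c : R) (h : nat -> R -> R) (s : R) :
  helmholtz_profile 1 h (c ^ 2 * s) ->
  helmholtz_profile c (fun k t => (c ^ 2) ^ k * h k (c ^ 2 * t)) s.
Proof.
  intros H k. destruct (H k) as [D E]. split.
  - evar_last.
    + apply is_derive_scal, is_derive_comp; [exact D|].
      apply is_derive_scal, @is_derive_id.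
    + unfold scal, one; simpl. unfold mult; simpl. ring.
  - replace (h k (c ^ 2 * s)) with
      (- ((4 * INR k + 6) * h (S k) (c ^ 2 * s)
         + 4 * (c ^ 2 * s) * h (S (S k)) (c ^ 2 * s))) by lra.
    simpl. ring.
Qed.

(* The recurrence of [helmholtz_profile] solved for its highest term, which is
   possible away from [s = 0]. *)
Fixpoint cos_profile (c : R) (k : nat) (s : R) : R :=
  match k with
  | O => / sqrt s * cos (c * sqrt s)
  | S k' =>
      match k' with
      | O => - c * sin (c * sqrt s) / (2 * s)
             - cos (c * sqrt s) / (2 * s * sqrt s)
      | S k'' => - (c ^ 2 * cos_profile c k'' s
                    + (4 * INR k'' + 6) * cos_profile c k' s) / (4 * s)
      end
  end.

Lemma cos_profile_SS (c : R) (k : nat) (s : R) :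
  cos_profile c (S (S k)) s =
  - (c ^ 2 * cos_profile c k s
     + (4 * INR k + 6) * cos_profile c (S k) s) / (4 * s).
Proof. reflexivity. Qed.

Lemma is_derive_recurrence (a b s f' g' : R) (f g : R -> R) :
  is_derive f s f' -> is_derive g s g' -> s <> 0 ->
  is_derive (fun t => - (a * f t + b * g t) / (4 * t)) s
    (- (a * f' + b * g') / (4 * s) + (a * f s + b * g s) / (4 * s ^ 2)).
Proof.
  intros Hf Hg Hs. auto_derive.
  - repeat split; [eexists; exact Hf | eexists; exact Hg | lra].
  - replace (Derive (fun t => f t) s) with f'
      by (symmetry; now apply is_derive_unique).
    replace (Derive (fun t => g t) s) with g'
      by (symmetry; now apply is_derive_unique).
    field. lra.
Qed.

Lemma is_derive_cos_profile (c : R) (k : nat) (s : R) :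
  0 < s -> is_derive (cos_profile c k) s (cos_profile c (S k) s).
Proof.
  intros Hs.
  assert (Hq := sqrt_lt_R0 s Hs).
  assert (E := sqrt_sqrt s (Rlt_le _ _ Hs)).
  (* The recurrence has order two, so the induction carries two consecutive derivatives. *)
  enough (H : is_derive (cos_profile c k) s (cos_profile c (S k) s) /\
    is_derive (cos_profile c (S k)) s (cos_profile c (S (S k)) s)) by apply H.
  induction k as [|k [IH1 IH2]].
  - split.
    + simpl. auto_derive; [repeat split; lra|].
      (* With [s = q * q] the goal becomes a rational identity in [q]. *)
      set (q := sqrt s) in *. rewrite <- E. field. lra.
    + rewrite cos_profile_SS. simpl. auto_derive; [repeat split; try lra; nra|].
      set (q := sqrt s) in *. rewrite <- E. field. lra.
  - split; [exact IH2|].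
    apply (is_derive_ext _ _ _ _ (fun t => eq_sym (cos_profile_SS c k t))).
    (* Differentiating the denominator [4 t] contributes [- h (k + 2) / s], which is exactly the
       change from [4 k + 6] to [4 (k + 1) + 6]. *)
    evar_last; [apply is_derive_recurrence; [exact IH1 | exact IH2 | lra]|].
    rewrite (cos_profile_SS c (S k)), cos_profile_SS, S_INR.
    field. lra.
Qed.

Lemma helmholtz_profile_cos (c s : R) :
  0 < s -> helmholtz_profile c (cos_profile c) s.
Proof.
  intros Hs k. split; [now apply is_derive_cos_profile|].
  rewrite cos_profile_SS. field. lra.
Qed.

(** The alternative [b = 0] serves the origin when the cosine term is absent: nothing is known of
    [q] there, but its coefficient kills it. *)
Lemma helmholtz_profile_comb (c a b : R) (p q : nat -> R -> R) (s : R) :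
  helmholtz_profile c p s -> helmholtz_profile c q s \/ b = 0 ->
  helmholtz_profile c (fun k t => a * p k t + b * q k t) s.
Proof.
  intros Hp Hq k. destruct (Hp k) as [Dp Ep]. destruct Hq as [Hq|Hb].
  - destruct (Hq k) as [Dq Eq]. split.
    + apply (is_derive_plus (fun t => a * p k t) (fun t => b * q k t));
        now apply is_derive_scal.
    + transitivity (a * ((4 * INR k + 6) * p (S k) s + 4 * s * p (S (S k)) s
                         + c ^ 2 * p k s)
        + b * ((4 * INR k + 6) * q (S k) s + 4 * s * q (S (S k)) s
               + c ^ 2 * q k s)); [ring | rewrite Ep, Eq; ring].
  - rewrite Hb. split.
    + replace (a * p (S k) s + 0 * q (S k) s) with (a * p (S k) s) by ring.
      apply (is_derive_ext (fun t => a * p k t));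
        [intros t; now rewrite Rmult_0_l, Rplus_0_r|].
      now apply is_derive_scal.
    + transitivity (a * ((4 * INR k + 6) * p (S k) s + 4 * s * p (S (S k)) s
                         + c ^ 2 * p k s)); [ring | rewrite Ep; ring].
Qed.

(** The extra factor [INR j] appears because [sin_profile 0 (j^2 r^2)] is [sin (j r) / (j r)],
    whereas [Psi] contains [sin (j r) / r]. *)
Definition psi_profile (j : nat) (alpha beta : R) (k : nat) (s : R) : R :=
  alpha * INR j * ((INR j ^ 2) ^ k * sin_profile k (INR j ^ 2 * s))
  + beta * cos_profile (INR j) k s.

Lemma helmholtz_profile_psi (j : nat) (alpha beta s : R) :
  0 < s \/ beta = 0 ->
  helmholtz_profile (INR j) (psi_profile j alpha beta) s.
Proof.
  intros Hs.
  apply (helmholtz_profile_comb _ (alpha * INR j) beta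
    (fun k t => (INR j ^ 2) ^ k * sin_profile k (INR j ^ 2 * t))).
  - apply helmholtz_profile_scale, helmholtz_profile_sin.
  - destruct Hs as [Hs|Hb]; [left; now apply helmholtz_profile_cos | now right].
Qed.

Lemma dot_self_nonneg (x : R3) : 0 <= dot x x.
Proof. destruct x as [[a b] c]. unfold dot, sum3; simpl. nra. Qed.

(* Valid at the origin too: both sides use the same value of [/ 0]. *)
Lemma radial_Psi (j : nat) (alpha beta : R) :
  radial (Psi j alpha beta) = fun x => psi_profile j alpha beta 0 (dot x x).
Proof.
  apply functional_extensionality. intros x.
  unfold radial, Psi, psi_profile, radius. simpl cos_profile.
  assert (Hr := sqrt_sqrt _ (dot_self_nonneg x)).
  set (r := sqrt (dot x x)) in *. rewrite <- Hr.
  rewrite Rmult_assoc. f_equal. f_equal.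
  unfold sin_over_r. destruct (Req_EM_T r 0) as [H0|H0].
  - rewrite H0, !Rmult_0_r. unfold sin_profile. rewrite PSeries_0.
    unfold sin_n. simpl. field.
  - rewrite sin_profile_sqr.
    replace ((INR j * r) ^ 2) with (INR j ^ 2 * (r * r)) by ring.
    simpl. field. exact H0.
Qed.

(** * Partial derivatives on an open set *)

(** Unlike the total function [partial], this relation asserts that the derivative exists. *)
Definition is_partial (i : axis) (f : R3 -> R) (x : R3) (l : R) : Prop :=
  is_derive (fun t => f (update i x t)) (coord i x) l.

(** Its coordinates act as the Kronecker delta in the formulas for second derivatives and
    Jacobians. *)
Definition basis (i : axis) : R3 := update i (0, 0, 0) 1.

Lemma update_coord (i : axis) (x : R3) : update i x (coord i x) = x.
Proof. now destruct i, x as [[a b] c]. Qed.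

Lemma is_partial_unique (i : axis) (f : R3 -> R) (x : R3) (l : R) :
  is_partial i f x l -> partial i f x = l.
Proof. apply is_derive_unique. Qed.

Lemma is_partial_const (i : axis) (a : R) (x : R3) :
  is_partial i (fun _ => a) x 0.
Proof. unfold is_partial. auto_derive; trivial. Qed.

Lemma is_partial_plus (i : axis) (f g : R3 -> R) (x : R3) (l m : R) :
  is_partial i f x l -> is_partial i g x m ->
  is_partial i (fun y => f y + g y) x (l + m).
Proof. apply @is_derive_plus. Qed.

Lemma is_partial_mult (i : axis) (f g : R3 -> R) (x : R3) (l m : R) :
  is_partial i f x l -> is_partial i g x m ->
  is_partial i (fun y => f y * g y) x (l * g x + f x * m).
Proof.
  intros Hf Hg. unfold is_partial.
  replace (l * g x + f x * m) with
    (l * g (update i x (coord i x)) + f (update i x (coord i x)) * m)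
    by now rewrite update_coord.
  apply (is_derive_mult _ _ _ _ _ Hf Hg). exact Rmult_comm.
Qed.

Lemma is_partial_coord (i k : axis) (x : R3) :
  is_partial i (coord k) x (coord k (basis i)).
Proof.
  destruct x as [[a b] c]. unfold is_partial.
  destruct i, k; simpl; auto_derive; trivial.
Qed.

Lemma is_partial_dot (i : axis) (A x : R3) :
  is_partial i (dot A) x (coord i A).
Proof.
  destruct x as [[a b] c]. unfold is_partial, dot, sum3.
  destruct i; simpl; auto_derive; trivial; ring.
Qed.

Lemma is_partial_cross (i k : axis) (A x : R3) :
  is_partial i (fun y => coord k (cross A y)) x (coord k (cross A (basis i))).
Proof.
  destruct x as [[a b] c]. unfold is_partial, basis, cross.
  destruct i, k; simpl; auto_derive; trivial; ring.
Qed.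

Lemma is_partial_sqr_dist (i : axis) (h : R -> R) (x : R3) (l : R) :
  is_derive h (dot x x) l ->
  is_partial i (fun y => h (dot y y)) x (2 * coord i x * l).
Proof.
  intros H. unfold is_partial. rewrite <- (update_coord i x) in H at 1 2.
  apply (is_derive_comp h (fun t => dot (update i x t) (update i x t)));
    [exact H|].
  destruct x as [[a b] c]. unfold dot, sum3.
  destruct i; simpl; auto_derive; trivial; ring.
Qed.

Lemma continuous_coord (i : axis) (x : R3) : continuous (coord i) x.
Proof.
  destruct i; simpl.
  - apply (continuous_comp (fun y : R3 => fst y) fst);
      apply continuous_fst.
  - apply (continuous_comp (fun y : R3 => fst y) snd);
      [apply continuous_fst | apply continuous_snd].
  - apply continuous_snd.
Qed.

Lemma continuous_add (f g : R3 -> R) (x : R3) :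
  continuous f x -> continuous g x -> continuous (fun y => f y + g y) x.
Proof. apply @continuous_plus. Qed.

Lemma continuous_mul (f g : R3 -> R) (x : R3) :
  continuous f x -> continuous g x -> continuous (fun y => f y * g y) x.
Proof. apply @continuous_mult. Qed.

Ltac split_continuous :=
  lazymatch goal with
  | |- continuous (fun y => @?f y + @?g y) _ => apply (continuous_add f g)
  | |- continuous (fun y => @?f y * @?g y) _ => apply (continuous_mul f g)
  | |- continuous (fun _ => ?a) _ => apply continuous_const
  | |- continuous (fun y => coord ?i y) _ => apply (continuous_coord i)
  end.

Lemma continuous_dot_l (A x : R3) : continuous (dot A) x.
Proof.
  unfold dot, sum3. repeat split_continuous.
Qed.

Lemma continuous_sqr_dist (x : R3) : continuous (fun y => dot y y) x.
Proof.
  unfold dot, sum3. repeat split_continuous.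
Qed.

Lemma continuous_cross (k : axis) (A x : R3) :
  continuous (fun y => coord k (cross A y)) x.
Proof.
  assert (H : forall a b i l, continuous
      (fun y : R3 => a * coord i y - b * coord l y) x).
  { intros a b i l. apply @continuous_minus;
      apply continuous_mul; (apply continuous_const || apply continuous_coord). }
  destruct k; apply H.
Qed.

Lemma continuous_update (i : axis) (x : R3) :
  continuous (fun t => update i x t) (coord i x).
Proof.
  apply filterlim_locally. intros eps.
  exists eps. intros t Ht. rewrite update_coord.
  destruct x as [[a b] c], i; repeat split; simpl;
    try exact Ht; apply ball_center.
Qed.

Lemma open_along_axis (D : R3 -> Prop) (i : axis) (x : R3) :
  open D -> D x -> locally (coord i x) (fun t => D (update i x t)).
Proof.
  intros HD Hx. apply (continuous_update i x).
  rewrite update_coord. now apply HD.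
Qed.

Lemma is_partial_ext (D : R3 -> Prop) (i : axis) (f g : R3 -> R) (x : R3)
    (l : R) :
  open D -> (forall y, D y -> f y = g y) -> D x ->
  is_partial i f x l -> is_partial i g x l.
Proof.
  intros HD E Hx. apply is_derive_ext_loc.
  apply (filter_imp (fun t => D (update i x t))); [intros t; apply E|].
  now apply open_along_axis.
Qed.

Lemma C_on_pred (n : nat) (D : R3 -> Prop) (f : R3 -> R) :
  C_on (S n) D f -> C_on n D f.
Proof.
  revert f. induction n as [|n IH]; intros f [Hc Hd].
  - now split.
  - split; [exact Hc|]. intros i. destruct (Hd i) as [Hex HC].
    split; [exact Hex | now apply IH].
Qed.

(** Openness lets agreement on [D] pass to the partial derivatives, but again only on [D]; hence the
    induction ranges over all pairs of functions agreeing there. *)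
Lemma C_on_ext (n : nat) (D : R3 -> Prop) (f g : R3 -> R) :
  open D -> (forall y, D y -> f y = g y) -> C_on n D f -> C_on n D g.
Proof.
  intros HD. revert f g. induction n as [|n IH]; intros f g E [Hc Hd].
  all: split; [intros x Hx; apply (continuous_ext_loc _ f);
    [apply (filter_imp D); [exact E | now apply HD] | now apply Hc]|].
  - exact I.
  - intros i. destruct (Hd i) as [Hex HC].
    assert (K : forall x, D x -> is_partial i g x (partial i f x)).
    { intros x Hx. apply (is_partial_ext D i f g); auto.
      apply Derive_correct. now apply Hex. }
    split.
    + intros x Hx. eexists. now apply K.
    + apply (IH (partial i f)); [|exact HC].
      intros y Hy. symmetry. now apply is_partial_unique, K.
Qed.

(** This lets smoothness be proved from closed formulas for the partial derivatives, in place of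
    iterated [Derive] terms. *)
Lemma C_on_intro (n : nat) (D : R3 -> Prop) (f : R3 -> R)
    (g : axis -> R3 -> R) :
  open D -> (forall x, D x -> continuous f x) ->
  (forall i x, D x -> is_partial i f x (g i x)) ->
  (forall i, C_on n D (g i)) -> C_on (S n) D f.
Proof.
  intros HD Hc Hp Hg. split; [exact Hc|]. intros i. split.
  - intros x Hx. eexists. now apply Hp.
  - apply (C_on_ext n D (g i)); auto.
    intros y Hy. symmetry. now apply is_partial_unique, Hp.
Qed.

Lemma C_on_scal (n : nat) (D : R3 -> Prop) (a : R) (f : R3 -> R) :
  open D -> C_on n D f -> C_on n D (fun x => a * f x).
Proof.
  intros HD. revert f. induction n as [|n IH]; intros f [Hc Hd].
  - split; [|exact I]. intros x Hx.
    apply continuous_mul; [apply continuous_const | now apply Hc].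
  - apply (C_on_intro n D _ (fun i x => a * partial i f x) HD).
    + intros x Hx.
      apply continuous_mul; [apply continuous_const | now apply Hc].
    + intros i x Hx. apply @is_derive_scal, Derive_correct, (Hd i), Hx.
    + intros i. apply IH, (Hd i).
Qed.

(** * The Beltrami field of a profile *)

Ltac prove_continuous :=
  repeat lazymatch goal with
  | |- continuous (fun y => coord ?i (cross ?A y)) _ =>
      apply (continuous_cross i A)
  | |- continuous (fun y => dot ?A y) _ => apply (continuous_dot_l A)
  | _ => split_continuous || solve [auto]
  end.

Lemma continuous_profile (c : R) (h : nat -> R -> R) (k : nat) (x : R3) :
  helmholtz_profile c h (dot x x) -> continuous (fun y => h k (dot y y)) x.
Proof.
  intros H. apply (continuous_comp (fun y : R3 => dot y y) (h k)).
  - apply continuous_sqr_dist.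
  - apply @ex_derive_continuous. eexists. apply H.
Qed.

Lemma is_partial_profile (c : R) (h : nat -> R -> R) (k : nat) (i : axis)
    (x : R3) :
  helmholtz_profile c h (dot x x) ->
  is_partial i (fun y => h k (dot y y)) x (2 * coord i x * h (S k) (dot x x)).
Proof. intros H. apply is_partial_sqr_dist, H. Qed.

Ltac compute_partial :=
  repeat lazymatch goal with
  | |- is_partial _ (fun y => @?f y + @?g y) _ _ => apply (is_partial_plus _ f g)
  | |- is_partial _ (fun y => @?f y * @?g y) _ _ => apply (is_partial_mult _ f g)
  | |- is_partial _ (fun _ => ?a) _ _ => apply is_partial_const
  | |- is_partial _ (fun y => coord ?i (cross ?A y)) _ _ =>
      apply (is_partial_cross _ i A)
  | |- is_partial _ (fun y => coord ?i y) _ _ => apply (is_partial_coord _ i)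
  | |- is_partial _ (fun y => dot ?A y) _ _ => apply (is_partial_dot _ A)
  | H : helmholtz_profile ?c ?h _ |- is_partial _ (fun y => ?h ?k _) _ _ =>
      apply (is_partial_profile c h k), H
  end.

Definition profile_grad (h : nat -> R -> R) (i : axis) (x : R3) : R :=
  2 * coord i x * h 1%nat (dot x x).

Definition profile_hess (h : nat -> R -> R) (k i : axis) (x : R3) : R :=
  2 * coord i (basis k) * h 1%nat (dot x x)
  + 4 * coord i x * coord k x * h 2%nat (dot x x).

Lemma is_partial_profile_grad (c : R) (h : nat -> R -> R) (k i : axis)
    (x : R3) :
  helmholtz_profile c h (dot x x) ->
  is_partial k (profile_grad h i) x (profile_hess h k i x).
Proof.
  intros H. unfold profile_grad, profile_hess.
  evar_last; [compute_partial | simpl; ring].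
Qed.

Lemma C_on_profile (c : R) (h : nat -> R -> R) (D : R3 -> Prop) :
  open D -> (forall x, D x -> helmholtz_profile c h (dot x x)) ->
  C_on 2 D (fun x => h 0%nat (dot x x)).
Proof.
  intros HD H.
  assert (Hc : forall k x, D x -> continuous (fun y => h k (dot y y)) x).
  { intros k x Hx. now apply (continuous_profile c), H. }
  apply (C_on_intro 1 D _ (profile_grad h)); auto.
  - intros i x Hx. now apply (is_partial_profile c), H.
  - intros i. apply (C_on_intro 0 D _ (fun k => profile_hess h k i)); auto.
    + intros x Hx. unfold profile_grad. prove_continuous.
    + intros k x Hx. now apply (is_partial_profile_grad c), H.
    + intros k. split; [|exact I].
      intros x Hx. unfold profile_hess. prove_continuous.
Qed.

(* The Laplacian has been replaced by its value [- c^2 h 0], so that only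
   [h 0], ..., [h 3] occur below. *)
Definition beltrami (c : R) (A : R3) (h : nat -> R -> R) (i : axis) (x : R3)
    : R :=
  2 * c * coord i (cross A x) * h 1%nat (dot x x)
  + 2 * coord i A * h 1%nat (dot x x)
  + 4 * dot A x * coord i x * h 2%nat (dot x x)
  + c ^ 2 * coord i A * h 0%nat (dot x x).

(** Here [k] is the direction of differentiation and [i] the component; each derivative of
    [h m |x|^2] gives [2 x_k h (m + 1)]. *)
Definition beltrami_jac (c : R) (A : R3) (h : nat -> R -> R) (k i : axis)
    (x : R3) : R :=
  2 * c * coord i (cross A (basis k)) * h 1%nat (dot x x)
  + 4 * c * coord i (cross A x) * coord k x * h 2%nat (dot x x)
  + 4 * (coord i A * coord k x + coord k A * coord i x
         + dot A x * coord i (basis k)) * h 2%nat (dot x x)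
  + 8 * dot A x * coord i x * coord k x * h 3%nat (dot x x)
  + 2 * c ^ 2 * coord i A * coord k x * h 1%nat (dot x x).

Lemma is_partial_beltrami (c : R) (A : R3) (h : nat -> R -> R) (k i : axis)
    (x : R3) :
  helmholtz_profile c h (dot x x) ->
  is_partial k (beltrami c A h i) x (beltrami_jac c A h k i x).
Proof.
  intros H. unfold beltrami, beltrami_jac. evar_last; [compute_partial | simpl; ring].
Qed.

(** Expanding, [curl u + c u = c (6 h 1 + 4 s h 2 + c^2 h 0) A]: the [h 3] terms are symmetric in
    [k] and [i], and the remaining terms cancel. The bracket is the Helmholtz equation at [k = 0],
    which explains the multipliers [c * a] in the proof. *)
Lemma beltrami_curl (c : R) (A : R3) (h : nat -> R -> R) (x : R3) :
  helmholtz_profile c h (dot x x) ->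
  let u i := beltrami c A h i x in
  let d k i := beltrami_jac c A h k i x in
  d ax2 ax3 - d ax3 ax2 = - c * u ax1 /\
  d ax3 ax1 - d ax1 ax3 = - c * u ax2 /\
  d ax1 ax2 - d ax2 ax1 = - c * u ax3.
Proof.
  intros H. assert (E := proj2 (H 0%nat)).
  simpl INR in E. cbv zeta. unfold beltrami, beltrami_jac.
  set (g0 := h 0%nat (dot x x)) in *. set (g1 := h 1%nat (dot x x)) in *.
  set (g2 := h 2%nat (dot x x)) in *. set (g3 := h 3%nat (dot x x)) in *.
  clearbody g0 g1 g2 g3. clear H. destruct A as [[a1 a2] a3], x as [[x1 x2] x3].
  unfold dot, sum3, cross, basis in *; simpl in *.
  assert (F := fun a => Rmult_eq_compat_l (c * a) _ _ E).
  repeat split.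
  - specialize (F a1). lra.
  - specialize (F a2). lra.
  - specialize (F a3). lra.
Qed.

(** The divergence equals [2 (A . x) (10 h 2 + 4 s h 3 + c^2 h 1)], a multiple of the equation at
    [k = 1]. The differentiated equation enters because the Laplacian has already been eliminated
    from [beltrami]. *)
Lemma beltrami_divergence_free (c : R) (A : R3) (h : nat -> R -> R) (x : R3) :
  helmholtz_profile c h (dot x x) ->
  sum3 (fun i => beltrami_jac c A h i i x) = 0.
Proof.
  intros H. assert (E := proj2 (H 1%nat)).
  simpl INR in E. unfold beltrami_jac.
  set (g1 := h 1%nat (dot x x)) in *.
  set (g2 := h 2%nat (dot x x)) in *. set (g3 := h 3%nat (dot x x)) in *.
  clearbody g1 g2 g3. clear H. destruct A as [[a1 a2] a3], x as [[x1 x2] x3].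
  unfold dot, sum3, cross, basis in *; simpl in *.
  assert (F := Rmult_eq_compat_l (2 * (a1 * x1 + a2 * x2 + a3 * x3)) _ _ E).
  lra.
Qed.

Lemma C_on_beltrami (c : R) (A : R3) (h : nat -> R -> R) (D : R3 -> Prop)
    (i : axis) :
  open D -> (forall x, D x -> helmholtz_profile c h (dot x x)) ->
  C_on 1 D (beltrami c A h i).
Proof.
  intros HD H.
  assert (Hc : forall k x, D x -> continuous (fun y => h k (dot y y)) x).
  { intros k x Hx. now apply (continuous_profile c), H. }
  apply (C_on_intro 0 D _ (fun k => beltrami_jac c A h k i) HD).
  - intros x Hx. unfold beltrami. prove_continuous.
  - intros k x Hx. now apply is_partial_beltrami, H.
  - intros k. split; [|exact I].
    intros x Hx. unfold beltrami_jac. prove_continuous.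
Qed.

(** The field [u] matches the closed formula only on [D], so its regularity and derivatives are
    transported from [beltrami] using that [D] is open. *)
Lemma beltrami_static_euler (c : R) (A : R3) (h : nat -> R -> R)
    (D : R3 -> Prop) (u : R3 -> R3) :
  open D -> (forall x, D x -> helmholtz_profile c h (dot x x)) ->
  (forall x i, D x -> component i u x = beltrami c A h i x) ->
  static_euler D u
    (fun x => - / 2 * sum3 (fun i => beltrami c A h i x * beltrami c A h i x)).
Proof.
  intros HD H Hu.
  assert (HC : forall i, C_on 1 D (beltrami c A h i)).
  { intros i. now apply C_on_beltrami. }
  assert (HBc : forall i x, D x -> continuous (beltrami c A h i) x).
  { exact (fun i => proj1 (HC i)). }
  assert (HB : forall k i x, D x ->
    is_partial k (beltrami c A h i) x (beltrami_jac c A h k i x)).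
  { intros k i x Hx. now apply is_partial_beltrami, H. }
  assert (HJ : forall k i x, D x -> continuous (beltrami_jac c A h k i) x).
  { intros k i x Hx.
    assert (Hc : forall m, continuous (fun y => h m (dot y y)) x).
    { intros m. now apply (continuous_profile c), H. }
    unfold beltrami_jac. prove_continuous. }
  (* The gradient of the pressure [- |u|^2 / 2], by the product rule. *)
  set (dP := fun k x =>
    - sum3 (fun i => beltrami c A h i x * beltrami_jac c A h k i x)).
  assert (HP : forall k x, D x -> is_partial k (fun x => - / 2 *
    sum3 (fun i => beltrami c A h i x * beltrami c A h i x)) x (dP k x)).
  { intros k x Hx. evar_last.
    - apply is_partial_mult; [apply is_partial_const|].
      unfold sum3. compute_partial; now apply HB.
    - unfold dP, sum3. field. }
  assert (HU : forall k i x, D x ->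
    partial k (component i u) x = beltrami_jac c A h k i x).
  { intros k i x Hx. apply is_partial_unique.
    apply (is_partial_ext D _ (beltrami c A h i)); auto.
    intros y Hy. symmetry. now apply Hu. }
  split; [|split].
  - intros i. apply (C_on_ext 1 D (beltrami c A h i)); auto.
    intros y Hy. symmetry. now apply Hu.
  - apply (C_on_intro 0 D _ dP HD).
    + intros x Hx. unfold sum3. prove_continuous.
    + exact HP.
    + intros k. split; [|exact I]. intros x Hx.
      unfold dP. apply @continuous_opp. unfold sum3. prove_continuous.
  - intros x Hx. split.
    + destruct (beltrami_curl c A h x (H x Hx)) as (E1 & E2 & E3).
      assert (Hui : forall i, coord i (u x) = beltrami c A h i x).
      { intros i. now apply Hu. }
      unfold add3, advect, grad, directional, dot, sum3, vec.
      unfold grad, vec. simpl coord.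
      rewrite !HU, !(is_partial_unique _ _ _ _ (HP _ x Hx)) by assumption.
      change (fst (fst (u x))) with (coord ax1 (u x)).
      change (snd (fst (u x))) with (coord ax2 (u x)).
      change (snd (u x)) with (coord ax3 (u x)).
      rewrite !Hui. unfold dP, sum3.
      set (u1 := beltrami c A h ax1 x) in *.
      set (u2 := beltrami c A h ax2 x) in *.
      set (u3 := beltrami c A h ax3 x) in *.
      (* [(u . nabla) u - nabla (|u|^2 / 2) = (curl u) x u] *)
      f_equal; [f_equal|].
      * transitivity
          (u3 * (beltrami_jac c A h ax3 ax1 x - beltrami_jac c A h ax1 ax3 x)
           - u2 * (beltrami_jac c A h ax1 ax2 x
                   - beltrami_jac c A h ax2 ax1 x));
          [ring | rewrite E2, E3; ring].
      * transitivity
          (u1 * (beltrami_jac c A h ax1 ax2 x - beltrami_jac c A h ax2 ax1 x)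
           - u3 * (beltrami_jac c A h ax2 ax3 x
                   - beltrami_jac c A h ax3 ax2 x));
          [ring | rewrite E1, E3; ring].
      * transitivity
          (u2 * (beltrami_jac c A h ax2 ax3 x - beltrami_jac c A h ax3 ax2 x)
           - u1 * (beltrami_jac c A h ax3 ax1 x
                   - beltrami_jac c A h ax1 ax3 x));
          [ring | rewrite E1, E2; ring].
    + unfold divergence, sum3. rewrite !HU by assumption.
      exact (beltrami_divergence_free c A h x (H x Hx)).
Qed.

(** The gradient of [psi] is [2 h 1 x], so [(A x nabla) phi] is [2 c h 1 (A x x)]. The Hessian
    applied to [A] gives [2 h 1 A + 4 (A . x) h 2 x], and the equation at [k = 0] turns
    [- A Delta psi] into [c^2 h 0 A]. *)
Lemma symplectic_field_beltrami (c : R) (A : R3) (h : nat -> R -> R)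
    (D : R3 -> Prop) (phi psi : R3 -> R) :
  open D -> (forall x, D x -> helmholtz_profile c h (dot x x)) ->
  psi = (fun x => h 0%nat (dot x x)) -> phi = (fun x => c * psi x) ->
  forall x i, D x ->
    component i (fun y => add3 (cross_grad A phi y)
                               (cross_grad_cross_grad A psi y)) x
    = beltrami c A h i x.
Proof.
  intros HD H Epsi Ephi x i Hx.
  assert (Hg : forall k y, D y -> is_partial k psi y (profile_grad h k y)).
  { intros k y Hy. rewrite Epsi. now apply (is_partial_profile c), H. }
  assert (Hphi : forall k, partial k phi x = c * profile_grad h k x).
  { intros k. apply is_partial_unique. rewrite Ephi.
    apply @is_derive_scal, Hg, Hx. }
  assert (Hh : forall k m, partial k (partial m psi) x = profile_hess h k m x).
  { intros k m. apply is_partial_unique.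
    apply (is_partial_ext D _ (profile_grad h m)); auto.
    - intros y Hy. symmetry. now apply is_partial_unique, Hg.
    - now apply (is_partial_profile_grad c), H. }
  assert (E := proj2 (H x Hx 0%nat)). simpl INR in E.
  unfold component, add3, cross_grad, cross_grad_cross_grad, laplacian,
    directional, grad, cross, dot at 1, sum3, vec.
  destruct i; simpl coord; rewrite ?Hphi, ?Hh;
    unfold beltrami, profile_grad, profile_hess;
    set (g0 := h 0%nat (dot x x)) in *; set (g1 := h 1%nat (dot x x)) in *;
    set (g2 := h 2%nat (dot x x)) in *; clearbody g0 g1 g2;
    clear - E; destruct A as [[a1 a2] a3], x as [[x1 x2] x3];
    unfold dot, sum3, cross, basis in *; simpl in *.
  - assert (F := Rmult_eq_compat_l a1 _ _ E). lra.
  - assert (F := Rmult_eq_compat_l a2 _ _ E). lra.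
  - assert (F := Rmult_eq_compat_l a3 _ _ E). lra.
Qed.

(** * Regular domain and periodicity *)

Lemma dot_self_eq0 (x : R3) : dot x x = 0 -> x = (0, 0, 0).
Proof.
  destruct x as [[a b] c]. unfold dot, sum3; simpl. intros H.
  replace a with 0 by nra. replace b with 0 by nra.
  now replace c with 0 by nra.
Qed.

(** In terms of [s = |x|^2] the domain is visibly open and matches the condition under which
    [psi_profile] solves the Helmholtz recurrence. *)
Lemma regular_domain_dot (beta : R) (x : R3) :
  regular_domain beta x <-> 0 < dot x x \/ beta = 0.
Proof.
  split; (intros [H|H]; [left | now right]).
  - destruct (dot_self_nonneg x) as [|E]; [assumption|].
    now destruct H; apply dot_self_eq0.
  - intros ->. unfold dot, sum3 in H; simpl in H. lra.
Qed.

Lemma open_regular_domain (beta : R) : open (regular_domain beta).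
Proof.
  apply (open_ext (fun x => 0 < dot x x \/ beta = 0)).
  - intros x. symmetry. apply regular_domain_dot.
  - apply open_or.
    + apply (open_comp (fun x : R3 => dot x x) (Rlt 0)).
      * intros x _. apply continuous_sqr_dist.
      * apply open_gt.
    + intros x Hb. now apply filter_forall.
Qed.

Lemma periodic_boundary_Psi (j : nat) (alpha beta : R) :
  periodic_boundary (Psi j alpha beta).
Proof.
  (* The continuous extension of [r * Psi r]: its value at 0 is [beta], while the literal product
     there is 0. It has period [2 * PI] because [j] is an integer. *)
  exists (fun r => alpha * sin (INR j * r) + beta * cos (INR j * r)).
  split; [|split].
  - intros xi Hxi. unfold Psi, sin_over_r.
    destruct (Req_EM_T xi 0) as [E|E]; [lra|]. field. exact E.
  - assert (C : continuous
      (fun r => alpha * sin (INR j * r) + beta * cos (INR j * r)) 0).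
    { apply @ex_derive_continuous. auto_derive. trivial. }
    intros Q HQ. destruct (C Q HQ) as [e He].
    exists e. intros y Hy _. now apply He.
  - intros r _.
    replace (INR j * (r + 2 * PI)) with (INR j * r + 2 * INR j * PI) by ring.
    now rewrite sin_period, cos_period.
Qed.

Lemma periodic_boundary_scal (a : R) (f : R -> R) :
  periodic_boundary f -> periodic_boundary (fun r => a * f r).
Proof.
  intros (w & Hw & Hlim & Hper). exists (fun r => a * w r).
  split; [|split].
  - intros xi Hxi. rewrite Hw by assumption. ring.
  - apply (filterlim_comp _ _ _ w (fun t => a * t) _ (locally (w 0)));
      [exact Hlim|].
    apply @ex_derive_continuous. auto_derive. trivial.
  - intros r Hr. now rewrite Hper.
Qed.

Theorem mainTheorem8 (A : R3) (alpha beta : R) (j : nat)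
    (hA : A <> (0, 0, 0)) (hj : (1 <= j)%nat) :
  let D := regular_domain beta in
  let phi := Phi j alpha beta in
  let psi := Psi j alpha beta in
  let u := fun x : R3 =>
    add3 (cross_grad A (radial phi) x)
         (cross_grad_cross_grad A (radial psi) x) in
  (exists P : R3 -> R, static_euler D u P) /\
  symplectic_representation D A phi psi u /\
  periodic_boundary phi /\ periodic_boundary psi.
Proof.
  intros D phi psi u.
  assert (HD : open D) by apply open_regular_domain.
  assert (H : forall x, D x ->
    helmholtz_profile (INR j) (psi_profile j alpha beta) (dot x x)).
  { intros x Hx. now apply helmholtz_profile_psi, regular_domain_dot. }
  assert (Epsi := radial_Psi j alpha beta).
  assert (C2 : C_on 2 D (radial psi)).
  { unfold psi. rewrite Epsi. now apply (C_on_profile (INR j)). }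
  split; [|split; [|split]].
  (* Unification supplies the pressure, half the squared norm of the closed formula with a minus
     sign. *)
  - eexists. apply (beltrami_static_euler _ A _ _ _ HD H).
    now apply (symplectic_field_beltrami _ A _ D (radial phi) (radial psi) HD H).
  - split; [|split; [exact C2 | reflexivity]].
    (* By conversion, [radial phi] is [INR j] times [radial psi]. *)
    apply (C_on_scal 1 D (INR j) (radial psi) HD).
    now apply C_on_pred.
  - apply periodic_boundary_scal, periodic_boundary_Psi.
  - apply periodic_boundary_Psi.
Qed.
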